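(* Let $X\in SO^{+}(2,1)$. Let $Z\in SL(2,\mathbf{R})$ be the positive definite matrix with $\Phi_{2,1}(Z)=X^TX$, let $W$ be the unique positive definite square root of $Z$ (so $W\in SL(2,\mathbf{R})$), and put $P=\Phi_{2,1}(W)$. Then: (1) if $W=\begin{pmatrix} w_1 & w_2 \\ w_2 & w_4 \end{pmatrix}$, then $P^{-1}=\Phi_{2,1}\begin{pmatrix} w_4 & -w_2 \\ -w_2 & w_1 \end{pmatrix}$; (2) with $V=XP^{-1}$, the factorization $X=VP$ is the polar decomposition of $X$ ($V$ special orthogonal, $P$ symmetric positive definite); (3) $V$ has the form $V=\begin{pmatrix} \cos\theta & -\sin\theta & 0 \\ \sin\theta & \cos\theta & 0 \\ 0 & 0 & 1 \end{pmatrix}$ for some $\theta\in[0,2\pi]$, and $S=\begin{pmatrix} \cos\frac{\theta}{2} & -\sin\frac{\theta}{2} \\ \sin\frac{\theta}{2} & \cos\frac{\theta}{2} \end{pmatrix}$ satisfies $\Phi_{2,1}(\pm S)=V$; (4) $Y=SW\in SL(2,\mathbf{R})$ satisfies $\Phi_{2,1}(\pm Y)=X$.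
   Context: $I_{2,1}=\mathrm{diag}(1,1,-1)$; $SO(2,1)=\{X\in M(3,\mathbf{R}): X^TI_{2,1}X=I_{2,1},\ \det X=1\}$ and $SO^{+}(2,1)$ is its identity component. The map $\Phi_{2,1}:SL(2,\mathbf{R})\to SO^{+}(2,1)$ is the double covering (a surjective group homomorphism with kernel $\{\pm I\}$) which sends $\begin{pmatrix} y_1 & y_2 \\ y_3 & y_4 \end{pmatrix}$ to $$\begin{pmatrix} 1+2y_2y_3 & y_2y_4-y_1y_3 & -(y_1y_3+y_2y_4) \\ y_3y_4-y_1y_2 & \tfrac12(y_1^2-y_2^2-y_3^2+y_4^2) & \tfrac12(y_1^2+y_2^2-y_3^2-y_4^2) \\ -(y_1y_2+y_3y_4) & \tfrac12(y_1^2-y_2^2+y_3^2-y_4^2) & \tfrac12(y_1^2+y_2^2+y_3^2+y_4^2) \end{pmatrix}.$$ Every positive definite matrix in $SO^{+}(2,1)$ has exactly one positive definite preimage in $SL(2,\mathbf{R})$ under $\Phi_{2,1}$. *)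

(* Defs.v *)
From mathcomp Require Import all_boot all_order all_algebra.
From mathcomp Require Import all_classical all_reals all_analysis.
Import Order.TTheory GRing.Theory Num.Theory.
Import numFieldNormedType.Exports.

Set Implicit Arguments.
Unset Strict Implicit.
Unset Printing Implicit Defensive.

Local Open Scope classical_set_scope.
Local Open Scope ring_scope.

Definition mx22 (R : realType) (a b c d : R) : 'M[R]_2 :=
  \matrix_(i < 2, j < 2) (nth [::] [:: [:: a; b]; [:: c; d]] i)`_j.

Definition mx33 (R : realType) (a b c d e f g h k : R) : 'M[R]_3 :=
  \matrix_(i < 3, j < 3)
    (nth [::] [:: [:: a; b; c]; [:: d; e; f]; [:: g; h; k]] i)`_j.

Definition SL2 (R : realType) : set 'M[R]_2 := [set Y | \det Y = 1].

Definition I21 (R : realType) : 'M[R]_3 := diag_mx (\row_j [:: 1; 1; -1]`_j).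

Definition SO21 (R : realType) : set 'M[R]_3 :=
  [set X | X^T *m I21 R *m X = I21 R /\ \det X = 1].

(* Connectedness is for the usual topology of 'M[R]_3. *)
Definition SOplus21 (R : realType) : set 'M[R]_3 :=
  connected_component (@SO21 R) 1%:M.

(* The formula is total on 'M[R]_2; the covering map is its restriction to
   SL2. *)
Definition Phi21 (R : realType) (Y : 'M[R]_2) : 'M[R]_3 :=
  let y1 := Y 0 0 in let y2 := Y 0 1 in
  let y3 := Y 1 0 in let y4 := Y 1 1 in
  mx33
    (1 + 2 * y2 * y3)
      (y2 * y4 - y1 * y3)
      (- (y1 * y3 + y2 * y4))
    (y3 * y4 - y1 * y2)
      ((y1 ^+ 2 - y2 ^+ 2 - y3 ^+ 2 + y4 ^+ 2) / 2)
      ((y1 ^+ 2 + y2 ^+ 2 - y3 ^+ 2 - y4 ^+ 2) / 2)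
    (- (y1 * y2 + y3 * y4))
      ((y1 ^+ 2 - y2 ^+ 2 + y3 ^+ 2 - y4 ^+ 2) / 2)
      ((y1 ^+ 2 + y2 ^+ 2 + y3 ^+ 2 + y4 ^+ 2) / 2).

(* Symmetry is part of positive definiteness. *)
Definition posdefmx (R : realType) (n : nat) (A : 'M[R]_n) : Prop :=
  A^T = A /\ forall v : 'cV[R]_n, v != 0 -> 0 < (v^T *m A *m v) 0 0.

Definition orthogonalmx (R : realType) (n : nat) (V : 'M[R]_n) : Prop :=
  V^T *m V = 1%:M.

Definition polar_factorization (R : realType) (n : nat) (X V P : 'M[R]_n) :
    Prop :=
  [/\ X = V *m P, orthogonalmx V & posdefmx P].

Definition is_the_polar_decomposition (R : realType) (n : nat)
    (X V P : 'M[R]_n) : Prop :=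
  polar_factorization X V P /\
  forall V' P' : 'M[R]_n, polar_factorization X V' P' -> V' = V /\ P' = P.

Definition rot2 (R : realType) (t : R) : 'M[R]_2 :=
  mx22 (cos t) (- sin t) (sin t) (cos t).

Definition rot3 (R : realType) (t : R) : 'M[R]_3 :=
  mx33 (cos t) (- sin t) 0 (sin t) (cos t) 0 0 0 1.

(* Main.v *)
(* On SO(2,1) the (3,3) entry z of X satisfies x^2 + y^2 = z^2 - 1 together with
   the rest (x, y, z) of its row, so it does not change sign on a connected
   subset; hence z > 0 on the identity component.  A positive definite W in SL(2)
   is determined by the last row of Phi(W), and every (x, y, z) as above with
   z > 0 arises in this way.  Choosing W so that Phi(W) has the last row of X, the
   matrix V = X Phi(W)^-1 lies in SO(2,1) and has last row (0, 0, 1), which forces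
   it to be a rotation of the first two coordinates.  Then X^T X = Phi(W)^2 =
   Phi(W^2), so Z = W^2, and X = V Phi(W) is the polar decomposition.  Phi(W) is
   positive definite because W = U^2 with U symmetric, whence
   Phi(W) = Phi(U)^T Phi(U). *)
Require Import Defs.
From mathcomp Require Import all_boot all_order all_algebra.
From mathcomp Require Import all_classical all_reals all_analysis.
From mathcomp Require Import ring lra.
Import Order.TTheory GRing.Theory Num.Theory.
Import numFieldNormedType.Exports.
Local Open Scope classical_set_scope.
Local Open Scope ring_scope.

(** * Explicit two by two and three by three matrices *)

Section Matrices.
Context {R : realType}.
Implicit Types a b c d e f g h k : R.

Lemma mx22_eta (A : 'M[R]_2) : A = mx22 (A 0 0) (A 0 1) (A 1 0) (A 1 1).
Proof.
by apply/matrixP => i j; rewrite mxE; case: i j => [[|[|//]] hi] [[|[|//]] hj] /=;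
  congr (A _ _); exact: val_inj.
Qed.

Lemma mx33_eta (A : 'M[R]_3) :
  A = mx33 (A 0 0) (A 0 1) (A 0 2) (A 1 0) (A 1 1) (A 1 2) (A 2 0) (A 2 1) (A 2 2).
Proof.
by apply/matrixP => i j; rewrite mxE;
  case: i j => [[|[|[|//]]] hi] [[|[|[|//]]] hj] /=; congr (A _ _); exact: val_inj.
Qed.

Lemma mx22_inj a b c d a' b' c' d' : mx22 a b c d = mx22 a' b' c' d' ->
  [/\ a = a', b = b', c = c' & d = d'].
Proof.
move=> /matrixP E; split.
- by have := E 0 0; rewrite !mxE.
- by have := E 0 1; rewrite !mxE.
- by have := E 1 0; rewrite !mxE.
- by have := E 1 1; rewrite !mxE.
Qed.

Lemma mul_mx22 a b c d a' b' c' d' :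
  mx22 a b c d *m mx22 a' b' c' d' =
  mx22 (a * a' + b * c') (a * b' + b * d') (c * a' + d * c') (c * b' + d * d').
Proof.
by apply/matrixP => i j; rewrite !mxE !big_ord_recl big_ord0 !mxE addr0;
  case: i j => [[|[|//]] hi] [[|[|//]] hj].
Qed.

Lemma tr_mx22 a b c d : (mx22 a b c d)^T = mx22 a c b d.
Proof.
by apply/matrixP => i j; rewrite !mxE; case: i j => [[|[|//]] hi] [[|[|//]] hj].
Qed.

Lemma det_mx22 a b c d : \det (mx22 a b c d) = a * d - b * c.
Proof.
rewrite (expand_det_row _ 0) !big_ord_recl big_ord0 /cofactor !det_mx11 !mxE /=.
by rewrite /bump /=; ring.
Qed.

Lemma scalar_mx22 a : a%:M = mx22 a 0 0 a.
Proof.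
by apply/matrixP => i j; rewrite !mxE; case: i j => [[|[|//]] hi] [[|[|//]] hj].
Qed.

Lemma mul_mx33 a b c d e f g h k a' b' c' d' e' f' g' h' k' :
  mx33 a b c d e f g h k *m mx33 a' b' c' d' e' f' g' h' k' =
  mx33
    (a * a' + b * d' + c * g') (a * b' + b * e' + c * h') (a * c' + b * f' + c * k')
    (d * a' + e * d' + f * g') (d * b' + e * e' + f * h') (d * c' + e * f' + f * k')
    (g * a' + h * d' + k * g') (g * b' + h * e' + k * h') (g * c' + h * f' + k * k').
Proof.
by apply/matrixP => i j; rewrite !mxE !big_ord_recl big_ord0 !mxE addr0 addrA;
  case: i j => [[|[|[|//]]] hi] [[|[|[|//]]] hj].
Qed.

Lemma tr_mx33 a b c d e f g h k :
  (mx33 a b c d e f g h k)^T = mx33 a d g b e h c f k.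
Proof.
by apply/matrixP => i j; rewrite !mxE;
  case: i j => [[|[|[|//]]] hi] [[|[|[|//]]] hj].
Qed.

Lemma det_mx33 a b c d e f g h k : \det (mx33 a b c d e f g h k) =
  a * (e * k - f * h) - b * (d * k - f * g) + c * (d * h - e * g).
Proof.
rewrite (expand_det_row _ 0) !big_ord_recl big_ord0 /cofactor.
rewrite !(expand_det_row _ 0) !big_ord_recl !big_ord0 /cofactor !det_mx11 !mxE /=.
by rewrite /bump /=; ring.
Qed.

Lemma scalar_mx33 a : a%:M = mx33 a 0 0 0 a 0 0 0 a.
Proof.
by apply/matrixP => i j; rewrite !mxE;
  case: i j => [[|[|[|//]]] hi] [[|[|[|//]]] hj].
Qed.

Lemma I21E : I21 R = mx33 1 0 0 0 1 0 0 0 (-1).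
Proof.
by apply/matrixP => i j; rewrite !mxE;
  case: i j => [[|[|[|//]]] hi] [[|[|[|//]]] hj]; rewrite ?mulr0n ?mulr1n.
Qed.

Lemma mx33_inj a b c d e f g h k a' b' c' d' e' f' g' h' k' :
  mx33 a b c d e f g h k = mx33 a' b' c' d' e' f' g' h' k' ->
  [/\ [/\ a = a', b = b' & c = c'], [/\ d = d', e = e' & f = f']
    & [/\ g = g', h = h' & k = k']].
Proof.
move=> /matrixP E; do 2?split.
- by have := E 0 0; rewrite !mxE.
- by have := E 0 1; rewrite !mxE.
- by have := E 0 2; rewrite !mxE.
- by have := E 1 0; rewrite !mxE.
- by have := E 1 1; rewrite !mxE.
- by have := E 1 2; rewrite !mxE.
- by have := E 2 0; rewrite !mxE.
- by have := E 2 1; rewrite !mxE.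
- by have := E 2 2; rewrite !mxE.
Qed.

Lemma cV2_eq0 (v : 'cV[R]_2) : v 0 0 = 0 -> v 1 0 = 0 -> v = 0.
Proof.
move=> v0 v1; apply/matrixP => -[[|[|//]] hi] j; rewrite (ord1 j) mxE.
- by rewrite -[RHS]v0; congr (v _ _); exact: val_inj.
- by rewrite -[RHS]v1; congr (v _ _); exact: val_inj.
Qed.

Lemma quadratic_form_mx22 a b c d (v : 'cV[R]_2) :
  (v^T *m mx22 a b c d *m v) 0 0 =
  a * v 0 0 ^+ 2 + (b + c) * v 0 0 * v 1 0 + d * v 1 0 ^+ 2.
Proof.
rewrite !mxE !big_ord_recl big_ord0 !mxE !big_ord_recl !big_ord0 !mxE /=.
rewrite (_ : lift 0 0 = 1) //; first by ring.
exact: val_inj.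
Qed.

End Matrices.

(** * Positive definite matrices and their square roots *)

Lemma posdefmx_diag_gt0 {R : realType} {n} (A : 'M[R]_n) (i : 'I_n) :
  posdefmx A -> 0 < A i i.
Proof.
move=> [_ pA]; have := pA (delta_mx i 0).
rewrite trmx_delta -rowE -colE !mxE; apply; apply/eqP => /matrixP/(_ i 0)/eqP.
by rewrite !mxE !eqxx oner_eq0.
Qed.

(** Completing the square: [a] times the form at [(x, y)] is [(a x + b y)^2 + (a d - b^2) y^2]. *)
Lemma posdefmx_mx22 {R : realType} (a b d : R) :
  posdefmx (mx22 a b b d) <-> 0 < a /\ 0 < a * d - b ^+ 2.
Proof.
split=> [pA|[a0 dA]].
- have a0 : 0 < a by have := posdefmx_diag_gt0 _ 0 pA; rewrite !mxE.
  (* The vector [(- b, a)] kills the completed square, so the form takes the value [a (a d - b^2)]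
     there. *)
  split=> //; case: pA => _ /(_ (\col_i [:: - b; a]`_i)).
  rewrite quadratic_form_mx22 !mxE /=.
  have -> : a * (- b) ^+ 2 + (b + b) * - b * a + d * a ^+ 2 = a * (a * d - b ^+ 2).
    by ring.
  rewrite pmulr_rgt0 //; apply; apply/eqP => /matrixP/(_ 1 0)/eqP.
  by rewrite !mxE /= gt_eqF.
split=> [|v v0]; first by rewrite tr_mx22.
rewrite quadratic_form_mx22 -(pmulr_rgt0 _ a0).
set x := v 0 0; set y := v 1 0.
have -> : a * (a * x ^+ 2 + (b + b) * x * y + d * y ^+ 2) =
  (a * x + b * y) ^+ 2 + (a * d - b ^+ 2) * y ^+ 2 by ring.
have [y0|y0] := eqVneq y 0.
  rewrite y0 expr0n /= !mulr0 !addr0 exprn_even_gt0 //= mulf_neq0 //.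
    by rewrite gt_eqF.
  by apply: contra v0 => /eqP x0; apply/eqP/cV2_eq0.
by apply: ltr_wpDl; rewrite ?sqr_ge0 // mulr_gt0 // exprn_even_gt0.
Qed.

(** The form at [v] is the sum of the squares of the entries of [B v], and [B v] is nonzero because
    [B] is invertible. *)
Lemma posdefmx_gram {R : realType} {n} (B : 'M[R]_n) :
  B \in unitmx -> posdefmx (B^T *m B).
Proof.
move=> uB; split=> [|v v0]; first by rewrite trmx_mul trmxK.
rewrite mulmxA -trmx_mul -mulmxA; have : B *m v != 0.
  by apply: contra v0 => /eqP/(congr1 (mulmx (invmx B))); rewrite mulKmx // mulmx0 => ->.
move: (B *m v) => u u0; rewrite mxE.
have u2 i : 0 <= u^T 0 i * u i 0 by rewrite mxE -expr2 sqr_ge0.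
rewrite lt_def sumr_ge0 // andbT; apply: contra u0; rewrite psumr_eq0 // => /allP u0.
apply/eqP/matrixP => i j; rewrite (ord1 j) !mxE; apply/eqP.
by have := u0 i (mem_index_enum _); rewrite mxE mulf_eq0 orbb.
Qed.

(* With D = Q - P one has D Q = - P D, so tr (D Q D) = - tr (D P D), while both
   traces are nonnegative and vanish only for D = 0. *)
Lemma posdefmx_sqr_inj {R : realType} {n} (P Q : 'M[R]_n) :
  posdefmx P -> posdefmx Q -> P *m P = Q *m Q -> P = Q.
Proof.
move=> pP pQ PQ; apply/eqP; rewrite eq_sym -subr_eq0; apply/eqP.
set D : 'M[R]_n := Q - P.
have sD : D^T = D by rewrite /D linearB /= pP.1 pQ.1.
have DQ : D *m Q = - (P *m D).
  by rewrite /D mulmxBl mulmxBr -PQ opprB.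
(* As [D] is symmetric, the diagonal entries of [D A D] are the values of the form [A] at the
   columns of [D]; a zero trace of [D Q D] therefore kills every column. *)
have quadE (A : 'M[R]_n) i : (D *m A *m D) i i = ((col i D)^T *m A *m col i D) 0 0.
  by rewrite tr_col sD -row_mul !mxE; apply: eq_bigr => j _; rewrite !mxE.
have quad_ge0 (A : 'M[R]_n) i : posdefmx A -> 0 <= (D *m A *m D) i i.
  move=> [_ pA]; rewrite quadE; have [->|/pA/ltW //] := eqVneq (col i D) 0.
  by rewrite mulmx0 mxE.
have tr_ge0 (A : 'M[R]_n) : posdefmx A -> 0 <= \tr (D *m A *m D).
  by move=> pA; apply: sumr_ge0 => i _; exact: quad_ge0.
have tr0 : \tr (D *m Q *m D) = 0.
  apply/eqP; rewrite eq_le tr_ge0 // andbT DQ mulNmx raddfN /= oppr_le0.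
  by rewrite mxtrace_mulC mulmxA tr_ge0.
suff colD i : col i D = 0.
  by apply/matrixP => i j; have /matrixP/(_ i 0) := colD j; rewrite !mxE.
have := @psumr_eq0P _ _ xpredT _ (fun k _ => quad_ge0 Q k pQ) tr0 i isT.
rewrite quadE; apply: contra_eq => /pQ.2.
by rewrite lt_def => /andP[].
Qed.

Lemma posdefmx_SL2_sqrt {R : realType} (Z : 'M[R]_2) : SL2 Z -> posdefmx Z ->
  exists W, [/\ SL2 W, posdefmx W & W *m W = Z].
Proof.
rewrite /SL2 /= (mx22_eta Z) => dZ pZ.
have b21 : Z 1 0 = Z 0 1 by case: pZ; rewrite tr_mx22 => /mx22_inj[].
move: dZ pZ; rewrite b21 det_mx22 => dZ /posdefmx_mx22[].
move: dZ; move: (Z 0 0) (Z 0 1) (Z 1 1) => a b d dZ a0 _.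
have d0 : 0 < d by nra.
(* By Cayley-Hamilton, [(tr W) W = Z + 1] and [(tr W)^2 = tr Z + 2]. *)
set t : R := Num.sqrt (a + d + 2).
have t0 : 0 < t by rewrite sqrtr_gt0; lra.
have t2 : t ^+ 2 = a + d + 2 by rewrite sqr_sqrtr //; lra.
have tn0 : t != 0 by rewrite gt_eqF.
have dW : (a + 1) / t * ((d + 1) / t) - b / t * (b / t) = 1.
  transitivity (((a * d - b * b) + a + d + 1) / t ^+ 2); first by field.
  by rewrite dZ t2; field; lra.
exists (mx22 ((a + 1) / t) (b / t) (b / t) ((d + 1) / t)); split.
- by rewrite /= det_mx22.
- apply/posdefmx_mx22; rewrite expr2 dW ltr01 divr_gt0 //; lra.
rewrite mul_mx22; have td : t ^+ 2 != 0 by rewrite expf_neq0.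
have b2 : b ^+ 2 = a * d - 1 by rewrite -dZ; ring.
congr mx22.
- transitivity (((a + 1) ^+ 2 + b ^+ 2) / t ^+ 2); first by field.
  by rewrite b2 t2; field; lra.
- transitivity (b * (a + d + 2) / t ^+ 2); first by field.
  by rewrite -t2 mulfK.
- transitivity (b * (a + d + 2) / t ^+ 2); first by field.
  by rewrite -t2 mulfK.
- transitivity (((d + 1) ^+ 2 + b ^+ 2) / t ^+ 2); first by field.
  by rewrite b2 t2; field; lra.
Qed.

(** * Algebra of the covering map on SL(2,R) *)

Section Covering.
Context {R : realType}.

(** Replacing the constant 1 by the determinant makes every entry a homogeneous quadratic.
    Multiplicativity then becomes an identity of polynomials. *)
Lemma Phi21_mx22 (a b c d : R) : a * d - b * c = 1 ->
  Phi21 (mx22 a b c d) = mx33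
    (a * d + b * c) (b * d - a * c) (- (a * c + b * d))
    (c * d - a * b)
      ((a ^+ 2 - b ^+ 2 - c ^+ 2 + d ^+ 2) / 2)
      ((a ^+ 2 + b ^+ 2 - c ^+ 2 - d ^+ 2) / 2)
    (- (a * b + c * d))
      ((a ^+ 2 - b ^+ 2 + c ^+ 2 - d ^+ 2) / 2)
      ((a ^+ 2 + b ^+ 2 + c ^+ 2 + d ^+ 2) / 2).
Proof.
move=> h; rewrite /Phi21 !mxE /=; congr mx33.
by rewrite -[X in X + _]h; ring.
Qed.

Lemma SL2_mul (A B : 'M[R]_2) : SL2 A -> SL2 B -> SL2 (A *m B).
Proof. by rewrite /SL2 /= det_mulmx => -> ->; rewrite mulr1. Qed.

Lemma Phi21M (A B : 'M[R]_2) : SL2 A -> SL2 B ->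
  Phi21 (A *m B) = Phi21 A *m Phi21 B.
Proof.
move=> dA dB; have := SL2_mul _ _ dA dB; move: dA dB; rewrite /SL2 /=.
rewrite (mx22_eta A) (mx22_eta B) mul_mx22 !det_mx22 => dA dB dAB.
rewrite !Phi21_mx22 // mul_mx33.
by congr mx33; field.
Qed.

Lemma Phi21_tr (A : 'M[R]_2) : Phi21 A^T = (Phi21 A)^T.
Proof.
by rewrite (mx22_eta A) tr_mx22 /Phi21 tr_mx33 !mxE /=; congr mx33; field.
Qed.

Lemma Phi21N (A : 'M[R]_2) : Phi21 (- A) = Phi21 A.
Proof. by rewrite /Phi21 !mxE; congr mx33; ring. Qed.

Lemma Phi21_1 : Phi21 (1%:M : 'M[R]_2) = 1%:M.
Proof.
by rewrite scalar_mx22 Phi21_mx22 ?scalar_mx33; [congr mx33; field | ring].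
Qed.

Lemma Phi21_SO21 (A : 'M[R]_2) : SL2 A -> SO21 (Phi21 A).
Proof.
rewrite /SL2 /SO21 /= (mx22_eta A) det_mx22.
move: (A 0 0) (A 0 1) (A 1 0) (A 1 1) => a b c d h.
(* In homogeneous form the diagonal entries of [Phi^T I21 Phi] are the square of the determinant up
   to sign, and the determinant of [Phi] is its cube. *)
have h2 : (a * d - b * c) ^+ 2 = 1 by rewrite h expr1n.
have h3 : (a * d - b * c) ^+ 3 = 1 by rewrite h expr1n.
rewrite Phi21_mx22 // I21E tr_mx33 !mul_mx33 det_mx33; split.
  congr mx33; try by field.
  - by transitivity ((a * d - b * c) ^+ 2); first by field.
  - by transitivity ((a * d - b * c) ^+ 2); first by field.
  - by transitivity (- (a * d - b * c) ^+ 2); [field | rewrite h2].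
by transitivity ((a * d - b * c) ^+ 3); first by field.
Qed.

Lemma SO21_unit (X : 'M[R]_3) : SO21 X -> X \in unitmx.
Proof. by move=> [_ dX]; rewrite unitmxE dX unitr1. Qed.

Lemma Phi21_unit (A : 'M[R]_2) : SL2 A -> Phi21 A \in unitmx.
Proof. by move=> /Phi21_SO21/SO21_unit. Qed.

Lemma posdefmx_sqr {n} (A : 'M[R]_n) :
  A \in unitmx -> A^T = A -> posdefmx (A *m A).
Proof. by move=> uA sA; rewrite -{1}sA; exact: posdefmx_gram. Qed.

Lemma posdefmx_Phi21 (W : 'M[R]_2) : SL2 W -> posdefmx W -> posdefmx (Phi21 W).
Proof.
move=> dW /(posdefmx_SL2_sqrt _ dW)[U [dU [sU _] <-]].
by rewrite Phi21M //; apply: posdefmx_sqr; rewrite ?Phi21_unit // -Phi21_tr sU.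
Qed.

(** The adjugate inverts a matrix of determinant one, and [Phi21] carries inverses to inverses. *)
Lemma invmx_Phi21 (a b c d : R) : a * d - b * c = 1 ->
  invmx (Phi21 (mx22 a b c d)) = Phi21 (mx22 d (- b) (- c) a).
Proof.
move=> h; have d1 : SL2 (mx22 a b c d) by rewrite /SL2 /= det_mx22.
have d2 : SL2 (mx22 d (- b) (- c) a) by rewrite /SL2 /= det_mx22 -h; ring.
have e : mx22 a b c d *m mx22 d (- b) (- c) a = 1%:M.
  by rewrite mul_mx22 scalar_mx22; congr mx22; try ring; rewrite -h; ring.
by rewrite -[RHS](mulKmx (Phi21_unit _ d1)) -Phi21M // e Phi21_1 mulmx1.
Qed.

(** For symmetric [Z] with entries [a, b, d] and determinant one, three entries of the image are
    [((a + d)^2 - 2) / 2], [- b (a + d)] and [(a - d) (a + d) / 2]. Positivity fixes the sign of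
    [a + d]; then [b] and [a - d] follow by division. *)
Lemma Phi21_posdefmx_inj (Z Z' : 'M[R]_2) :
  SL2 Z -> SL2 Z' -> posdefmx Z -> posdefmx Z' -> Phi21 Z = Phi21 Z' -> Z = Z'.
Proof.
rewrite (mx22_eta Z) (mx22_eta Z') /SL2 /=.
move=> + + pZ pZ'; move: (pZ) (pZ').
case: pZ; rewrite tr_mx22 => /mx22_inj[_ -> _ _] _.
case: pZ'; rewrite tr_mx22 => /mx22_inj[_ -> _ _] _.
move: (Z 0 0) (Z 0 1) (Z 1 1) (Z' 0 0) (Z' 0 1) (Z' 1 1) => a b d a' b' d'.
rewrite !det_mx22 => /posdefmx_mx22[a0 _] /posdefmx_mx22[a0' _] h h'.
have d0 : 0 < d by nra.
have d0' : 0 < d' by nra.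
rewrite !Phi21_mx22 // => /mx33_inj[_ [_ _ E12] [E20 _ E22]].
have tt : a + d = a' + d'.
  apply/eqP; rewrite -(@eqrXn2 _ 2) ?addr_ge0 ?ltW //; apply/eqP.
  by nra.
have t0 : a + d != 0 by rewrite gt_eqF ?addr_gt0.
have bb : b = b'.
  by apply: (mulIf t0); rewrite {2}tt; lra.
have dd : a - d = a' - d'.
  by apply: (mulIf t0); rewrite {2}tt; lra.
by congr mx22; lra.
Qed.

(** * The group SO(2,1), its identity component and last rows *)

Lemma SOplus21_sub_SO21 (X : 'M[R]_3) : SOplus21 X -> SO21 X.
Proof. exact: connected_component_sub. Qed.

Lemma SO21_tr (X : 'M[R]_3) : SO21 X -> SO21 X^T.
Proof.
move=> sX; have uX := SO21_unit _ sX; case: sX => XIX dX.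
have II : I21 R *m I21 R = 1%:M.
  by rewrite I21E mul_mx33 scalar_mx33; congr mx33; ring.
split; last by rewrite det_tr.
have : (I21 R *m X^T *m I21 R) *m X = 1%:M by rewrite -!mulmxA (mulmxA X^T) XIX.
move=> /mulmx1C.
rewrite trmxK => /(congr1 (mulmx^~ (I21 R))).
by rewrite -!mulmxA II mulmx1 mul1mx !mulmxA.
Qed.

Lemma SO21_mul (X Y : 'M[R]_3) : SO21 X -> SO21 Y -> SO21 (X *m Y).
Proof.
move=> [XI dX] [YI dY]; split; last by rewrite det_mulmx dX dY mulr1.
by rewrite trmx_mul -!mulmxA (mulmxA X^T) (mulmxA _ X) XI mulmxA.
Qed.

Lemma SO21_inv (X : 'M[R]_3) : SO21 X -> SO21 (invmx X).
Proof.
move=> sX; have uX := SO21_unit _ sX; case: sX => XI dX.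
split; last by rewrite det_inv dX invr1.
by rewrite -{1}XI -!mulmxA mulmxV // mulmx1 mulmxA -trmx_mul mulmxV // trmx1 mul1mx.
Qed.

Lemma SO21_row2 (X : 'M[R]_3) : SO21 X ->
  X 2 0 ^+ 2 + X 2 1 ^+ 2 = X 2 2 ^+ 2 - 1.
Proof.
move=> /SO21_tr[]; rewrite trmxK (mx33_eta X) I21E tr_mx33 !mul_mx33 !mxE /=.
by move=> /mx33_inj[_ _ [_ _ h]] _; lra.
Qed.

(* X 2 2 never vanishes on SO(2,1), and it is 1 at the identity. *)
Lemma SOplus21_gt0 (X : 'M[R]_3) : SOplus21 X -> 0 < X 2 2.
Proof.
move=> [C [C1 CSO cC] CX]; rewrite ltNge; apply/negP => X0.
have /connected_intervalP itvC : connected ((fun M : 'M[R]_3 => M 2 2) @` C).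
  apply: connected_continuous_connected => //.
  exact/continuous_subspaceT/coord_continuous.
have [] := itvC (X 2 2) 1 _ _ 0; first by exists X.
- by exists 1%:M => //; rewrite mxE.
- by rewrite X0 ler01.
move=> Y /CSO/SO21_row2 + Y0; rewrite Y0 => h.
by have := sqr_ge0 (Y 2 0); have := sqr_ge0 (Y 2 1); lra.
Qed.

Lemma SOplus21_row2_lift (x y z : R) : 0 < z -> x ^+ 2 + y ^+ 2 = z ^+ 2 - 1 ->
  exists W : 'M[R]_2, [/\ SL2 W, posdefmx W &
    [/\ Phi21 W 2 0 = x, Phi21 W 2 1 = y & Phi21 W 2 2 = z]].
Proof.
move=> z0 h; set t : R := Num.sqrt (2 * z + 2).
have t0 : 0 < t by rewrite sqrtr_gt0; lra.
have t2 : t ^+ 2 = 2 * z + 2 by rewrite sqr_sqrtr //; lra.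
have tn0 : t != 0 by rewrite gt_eqF.
have z1 : z + 1 != 0 by rewrite gt_eqF //; lra.
(* These solve [a + d = t], [- b (a + d) = x] and [(a - d) (a + d) / 2 = y], where [t^2 = 2 z + 2]
   is forced by the last entry and determinant one. *)
set a := (t + 2 * y / t) / 2; set b := - x / t; set d := (t - 2 * y / t) / 2.
have ad : a + d = t by rewrite /a /d; field.
have ab : b * t = - x by rewrite /b; field.
have amd : (a - d) * t = 2 * y by rewrite /a /d; field.
have dW : a * d - b * b = 1.
  have -> : a * d - b * b = ((t ^+ 2) ^+ 2 - 4 * (x ^+ 2 + y ^+ 2)) / (4 * t ^+ 2).
    by rewrite /a /b /d; field.
  by rewrite h t2; field; lra.
clearbody a b d.
(* The product [a d = 1 + b^2] and the sum [a + d = t] are both positive. *)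
have a0 : 0 < a by have := sqr_ge0 b; nra.
exists (mx22 a b b d); split.
- by rewrite /SL2 /= det_mx22.
- by apply/posdefmx_mx22; rewrite expr2 dW.
rewrite Phi21_mx22 // !mxE /=; split.
- by rewrite -[RHS]opprK -ab -ad; ring.
- have -> : y = (a - d) * (a + d) / 2 by rewrite ad amd; field.
  by ring.
have : z = ((a + d) ^+ 2 - 2) / 2 by rewrite ad t2; field.
by lra.
Qed.

(** * Rotations in SO(2,1) and their lifts *)

Lemma exists_angle (c s : R) : c ^+ 2 + s ^+ 2 = 1 ->
  exists theta : R, [/\ 0 <= theta <= 2 * pi, cos theta = c & sin theta = s].
Proof.
move=> h; have c1 : -1 <= c <= 1 by apply/andP; split; nra.
have [/andP[t0 tpi] ct] := acos_def c1.
have st : sin (acos c) = `|s|.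
  by rewrite sin_acos // -h addrAC subrr add0r sqrtr_sqr.
have pi0 : 0 <= pi :> R := pi_ge0 R.
have [s0|s0] := leP 0 s.
  by exists (acos c); split=> //; [lra | rewrite st ger0_norm].
(* The arccosine only reaches angles with nonnegative sine; reflecting it to [2 pi - acos c] keeps
   the cosine and negates the sine. *)
exists (pi *+ 2 - acos c); split; first by rewrite mulr2n; lra.
  by rewrite addrC cosD2pi cosN.
by rewrite addrC sinD2pi sinN st ltr0_norm // opprK.
Qed.

Lemma addr_sqr_eq0 (x y : R) : x ^+ 2 + y ^+ 2 = 0 -> x = 0 /\ y = 0.
Proof.
by move=> /eqP; rewrite paddr_eq0 ?sqr_ge0 // !sqrf_eq0 => /andP[/eqP -> /eqP ->].
Qed.

Lemma SO21_fix_rot3 (V : 'M[R]_3) : SO21 V ->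
  V 2 0 = 0 -> V 2 1 = 0 -> V 2 2 = 1 ->
  exists theta, 0 <= theta <= 2 * pi /\ V = rot3 theta.
Proof.
move=> [+ +] h0 h1 h2; rewrite (mx33_eta V) h0 h1 h2.
move: (V 0 0) (V 0 1) (V 0 2) (V 1 0) (V 1 1) (V 1 2) => a b x c d y.
rewrite I21E tr_mx33 !mul_mx33 det_mx33 => /mx33_inj[[e00 e01 _] [_ e11 _] [_ _ e22]] e.
have [x0 y0] : x = 0 /\ y = 0 by apply: addr_sqr_eq0; lra.
have [ad bc] : d = a /\ b = - c.
  (* The first two columns have norm one and the determinant is [a d - b c = 1], so the sum of
     squares expands to [2 - 2]. *)
  have /addr_sqr_eq0[] : (d - a) ^+ 2 + (b + c) ^+ 2 = 0 by rewrite x0 y0 in e; lra.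
  by split; lra.
have [theta [tI ct st]] := exists_angle a c ltac:(lra).
by exists theta; split=> //; rewrite /rot3 ct st ad bc x0 y0.
Qed.

Lemma det_rot3 (t : R) : \det (rot3 t) = 1.
Proof. by rewrite det_mx33 -[RHS](cos2Dsin2 t); ring. Qed.

Lemma rot3_orthogonal (t : R) : orthogonalmx (rot3 t).
Proof.
rewrite /orthogonalmx tr_mx33 mul_mx33 scalar_mx33.
congr mx33; try ring; by rewrite -[RHS](cos2Dsin2 t); ring.
Qed.

Lemma SL2_rot2 (t : R) : SL2 (rot2 t).
Proof. by rewrite /SL2 /= det_mx22 -[RHS](cos2Dsin2 t); ring. Qed.

(** The entries of [Phi21] are quadratic, so at a rotation they are double-angle formulas; this is
    why the angle is halved. *)
Lemma Phi21_rot2 (t : R) : Phi21 (rot2 (t / 2)) = rot3 t.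
Proof.
have h := cos2Dsin2 (t / 2).
have -> : rot3 t = rot3 (t / 2 + t / 2) by congr rot3; field.
rewrite /rot3 sinD cosD Phi21_mx22; last by rewrite -[RHS]h; ring.
congr mx33; try by field.
by rewrite -[RHS]h; field.
Qed.

(** * Polar decomposition on the identity component and its lift to SL(2,R) *)

Lemma SOplus21_polar (X : 'M[R]_3) : SOplus21 X ->
  exists W : 'M[R]_2, [/\ SL2 W, posdefmx W &
    exists theta, 0 <= theta <= 2 * pi /\ X *m invmx (Phi21 W) = rot3 theta].
Proof.
move=> sX; have X0 := SOplus21_gt0 _ sX; have oX := SOplus21_sub_SO21 _ sX.
have [W [dW pW [e0 e1 e2]]] := SOplus21_row2_lift _ _ _ X0 (SO21_row2 _ oX).
have oP := Phi21_SO21 _ dW.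
exists W; split=> //.
have r2 : row 2 (X *m invmx (Phi21 W)) = row 2 1%:M.
  rewrite row_mul (_ : row 2 X = row 2 (Phi21 W)).
    by rewrite -row_mul mulmxV ?SO21_unit.
  apply/rowP => -[[|[|[|//]]] hi]; rewrite [LHS]mxE [RHS]mxE.
  - by rewrite (_ : Ordinal hi = 0) ?e0 //; exact: val_inj.
  - by rewrite (_ : Ordinal hi = 1) ?e1 //; exact: val_inj.
  - by rewrite (_ : Ordinal hi = 2) ?e2 //; exact: val_inj.
have VE j : (X *m invmx (Phi21 W)) 2 j = (2 == j)%:R.
  by have /rowP/(_ j) := r2; rewrite [LHS]mxE [RHS]mxE => ->; rewrite mxE.
by apply: SO21_fix_rot3; rewrite ?VE //; exact/SO21_mul/SO21_inv.
Qed.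

End Covering.

Theorem mainTheorem5 (R : realType) (X : 'M[R]_3) (hX : SOplus21 X) :
  (exists! Z : 'M[R]_2, [/\ SL2 Z, posdefmx Z & Phi21 Z = X^T *m X]) /\
  forall Z : 'M[R]_2, SL2 Z -> posdefmx Z -> Phi21 Z = X^T *m X ->
  (exists! W : 'M[R]_2, posdefmx W /\ W *m W = Z) /\
  forall W : 'M[R]_2, posdefmx W -> W *m W = Z ->
  SL2 W /\
  let P := Phi21 W in
  let V := X *m invmx P in
  [/\ (forall w1 w2 w4 : R, W = mx22 w1 w2 w2 w4 ->
        P \in unitmx /\ invmx P = Phi21 (mx22 w4 (- w2) (- w2) w1)),
      is_the_polar_decomposition X V P /\ \det V = 1,
      (exists theta : R, 0 <= theta <= 2 * pi /\ V = rot3 theta) &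
      forall theta : R, 0 <= theta <= 2 * pi -> V = rot3 theta ->
        let S := rot2 (theta / 2) in
        let Y := S *m W in
        (Phi21 S = V /\ Phi21 (- S) = V) /\
        [/\ SL2 Y, Phi21 Y = X & Phi21 (- Y) = X]].
Proof.
have [W0 [dW0 pW0 [t0 [t0I V0]]]] := SOplus21_polar X hX.
have uP := Phi21_unit W0 dW0; have pP := posdefmx_Phi21 W0 dW0 pW0.
have XE : X = rot3 t0 *m Phi21 W0 by rewrite -V0 mulmxKV.
(* The rotation cancels in [X^T X], leaving the square of the symmetric factor. *)
have XX : X^T *m X = Phi21 W0 *m Phi21 W0.
  rewrite {1 2}XE trmx_mul -mulmxA (mulmxA (rot3 t0)^T) rot3_orthogonal mul1mx.
  by rewrite pP.1.
have sW0 : W0^T = W0 := pW0.1.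
have pZ0 : posdefmx (W0 *m W0).
  by apply: posdefmx_sqr => //; rewrite unitmxE dW0 unitr1.
have dZ0 := SL2_mul _ _ dW0 dW0.
have PZ0 : Phi21 (W0 *m W0) = X^T *m X by rewrite Phi21M // XX.
have Z_unique Z : SL2 Z -> posdefmx Z -> Phi21 Z = X^T *m X -> W0 *m W0 = Z.
  by move=> dZ pZ PZ; apply: Phi21_posdefmx_inj; rewrite // PZ0.
split; first by exists (W0 *m W0); split=> [|Z []]; [split | exact: Z_unique].
move=> Z dZ pZ PZ; have W0Z := Z_unique Z dZ pZ PZ.
have W_unique W : posdefmx W -> W *m W = Z -> W0 = W.
  by move=> pW WZ; apply: posdefmx_sqr_inj; rewrite // W0Z.
split; first by exists W0; split=> // W []; exact: W_unique.
(* Uniqueness of the square root identifies the given [W] with [W0], so [V] is the rotation already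
   found. *)
move=> W pW WZ; rewrite -(W_unique W pW WZ); split=> // P V.
have V0' : V = rot3 t0 by [].
split.
- move=> w1 w2 w4 WE; split=> //; rewrite /P WE invmx_Phi21 //.
  by move: dW0; rewrite WE /SL2 /= det_mx22.
- split; last by rewrite V0' det_rot3.
  split; first by split=> //; rewrite V0' //; exact: rot3_orthogonal.
  move=> V' P' [XE' oV' pP'].
  (* Orthogonality of [V'] gives [P'^2 = X^T X = P^2], and positive definite square roots are
     unique; [V'] is then [X P^-1]. *)
  have PP' : P' = P.
    apply: posdefmx_sqr_inj => //; rewrite -[RHS]XX XE' trmx_mul -mulmxA.
    by rewrite (mulmxA V'^T) oV' mul1mx pP'.1.
  by split=> //; rewrite /V XE' PP' mulmxK.
- by exists t0.
(* Here [t] is any angle representing [V], possibly different from [t0]. *)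
move=> t _ Vt S Y; have SV : Phi21 S = V by rewrite Phi21_rot2 Vt.
have dS : SL2 S := SL2_rot2 _.
have YX : Phi21 Y = X by rewrite Phi21M // SV mulmxKV.
by rewrite !Phi21N SV YX; do !split=> //; exact: SL2_mul.
Qed.
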